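(* Let $\mathbf{X}\subset\mathbb{R}^n$ be bounded, let $g_1,\ldots,g_N\in\mathbb{R}[\mathbf{x}]$ be polynomials, and for $i=1,\ldots,N$ let $$\mathbf{X}_i=\{\mathbf{x}\in\mathbf{X} \mid g_i(\mathbf{x})<g_j(\mathbf{x})\ \ \forall j\neq i\}.$$ Let $c_1,\ldots,c_N\in\mathbb{R}$ be distinct and let $f:\mathbf{X}\to\mathbb{R}$ be a piecewise constant function satisfying $f(\mathbf{x})=c_i$ for all $\mathbf{x}\in\mathbf{X}_i$, $i=1,\ldots,N$. Then there exists a polynomial $p\in\mathbb{R}[\mathbf{x},y]$ such that $$f(\mathbf{x})=\arg\min_{y\in\mathbb{R}}p(\mathbf{x},y)\quad\text{for all } \mathbf{x}\in\bigcup_{i=1}^N\mathbf{X}_i .$$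
   Context: $\mathbb{R}[\mathbf{x},y]$ is the ring of real polynomials in $\mathbf{x}\in\mathbb{R}^n$ and $y\in\mathbb{R}$. The equality $f(\mathbf{x})=\arg\min_{y\in\mathbb{R}}p(\mathbf{x},y)$ means that $y=f(\mathbf{x})$ is the unique global minimizer over $\mathbb{R}$ of the univariate polynomial $y\mapsto p(\mathbf{x},y)$. The values of $f$ at points of $\mathbf{X}$ outside $\bigcup_i\mathbf{X}_i$ are arbitrary. *)

(* Defs.v *)
From HB Require Import structures.
From mathcomp Require Import all_boot all_order all_algebra.
From mathcomp Require Import all_classical all_reals all_analysis.
(* Importing mpoly would clash with the notations of MathComp-Analysis, so its
   identifiers are qualified: mpoly.mpoly n R is the ring {mpoly R[n]}. *)
From mathcomp Require mpoly.

Set Implicit Arguments.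
Unset Strict Implicit.
Unset Printing Implicit Defensive.

Import Order.TTheory GRing.Theory Num.Theory.
Import numFieldNormedType.Exports.

Local Open Scope classical_set_scope.
Local Open Scope ring_scope.

Definition evalv (R : realType) (m : nat) (q : mpoly.mpoly m R) (v : 'rV[R]_m)
    : R :=
  mpoly.meval (fun k => v ord0 k) q.

(* R[x, y] is {mpoly R[n + 1]}; the last indeterminate is y. *)
Definition evalxy (R : realType) (n : nat) (p : mpoly.mpoly (n + 1) R)
    (x : 'rV[R]_n) (y : R) : R :=
  evalv p (row_mx x y%:M).

Definition region (R : realType) (n N : nat) (X : set 'rV[R]_n)
    (g : 'I_N -> mpoly.mpoly n R) (i : 'I_N) : set 'rV[R]_n :=
  [set x | X x /\ forall j, j != i -> evalv (g i) x < evalv (g j) x].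

Definition is_global_minimizer (R : realType) (h : R -> R) (y : R) : Prop :=
  forall z, h y <= h z.

Definition is_argmin (R : realType) (h : R -> R) (y : R) : Prop :=
  unique (is_global_minimizer h) y.

(* Main.v *)
(* Choose univariate polynomials h_i >= 0 with h_i(c_j) = (i == j) whose sum is
   larger than 1 away from the nodes c_j, and a constant K with g_i + K > 0
   on X, and let p(x, y) = sum_i (g_i(x) + K) h_i(y). Then
   p(x, c_i) = g_i(x) + K, and for y different from all nodes p(x, y) is at
   least min_i (g_i(x) + K) times the sum of the h_i(y), hence larger than
   this minimum. *)

Require Import Defs.
From HB Require Import structures.
From mathcomp Require Import all_boot all_order all_algebra.
From mathcomp Require Import all_classical all_reals all_analysis.
From mathcomp Require Import ring lra.
From mathcomp Require mpoly.

Set Implicit Arguments.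
Unset Strict Implicit.
Unset Printing Implicit Defensive.

Import Order.TTheory GRing.Theory Num.Theory.
Import numFieldNormedType.Exports.

Local Open Scope classical_set_scope.
Local Open Scope ring_scope.

Lemma dvdp_prod_coprimep (F : fieldType) (I : eqType) (r : seq I)
    (q : I -> {poly F}) (p : {poly F}) :
    uniq r -> (forall i j, i != j -> coprimep (q i) (q j)) ->
    (forall i, q i %| p) ->
  \prod_(i <- r) q i %| p.
Proof.
move=> + cop dvd; elim: r => [|i r IHr] /=; first by rewrite big_nil dvd1p.
move=> /andP[ir ur]; rewrite big_cons Gauss_dvdp ?dvd ?IHr //.
rewrite big_seq; apply: (big_ind (coprimep (q i))) => [|a b|j jr]; first exact: coprimep1.
  by rewrite coprimepMr => -> ->.
by apply: cop; apply: contraNneq ir => ->.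
Qed.

Lemma dvdp_sqr_XsubC (F : fieldType) (a : F) (p : {poly F}) :
  p.[a] = 0 -> p^`().[a] = 0 -> ('X - a%:P) ^+ 2 %| p.
Proof.
move=> /rootP/factor_theorem[q ->].
rewrite derivM derivXsubC mulr1 !hornerE subrr mulr0 add0r.
by move=> /rootP/factor_theorem[s ->]; rewrite -mulrA -expr2 dvdp_mulIr.
Qed.

(* The Hermite interpolants [H i] of [i == j] with zero derivatives at the nodes
   sum to 1 by uniqueness. With [w] the nodal polynomial, [w ^+ 2] is
   [L i ^+ 2] times the square of a multiple of ['X - (c i)%:P], so adding a
   large multiple of it makes up for the sign change of the linear factor of
   [H i]. *)
Lemma nonneg_hermite (R : realFieldType) (N : nat) (c : 'I_N -> R) :
    (0 < N)%N -> injective c ->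
  exists h : 'I_N -> {poly R},
    [/\ forall i y, 0 <= (h i).[y],
        forall i j, (h i).[c j] = (i == j)%:R &
        forall y, (forall j, y != c j) -> 1 < \sum_i (h i).[y]].
Proof.
move=> N0 cinj.
pose w := \prod_j ('X - (c j)%:P).
(* [L i] is the Lagrange basis polynomial of the node [c i]; its normalizing constant [d i] is the
   value at [c i] of the product of the other linear factors. *)
have [d [L [d0 LE wE]]] : exists (d : 'I_N -> R) (L : 'I_N -> {poly R}),
    [/\ forall i, d i != 0, forall i j, (L i).[c j] = (i == j)%:R &
        forall i, w = ('X - (c i)%:P) * (d i *: L i)].
  pose P i := \prod_(j | j != i) ('X - (c j)%:P).
  have PE i y : (P i).[y] = \prod_(j | j != i) (y - c j).
    by rewrite horner_prod; apply: eq_bigr => j _; rewrite !hornerE.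
  have P0 i : (P i).[c i] != 0.
    rewrite PE; apply/prodf_neq0 => j ji.
    by rewrite subr_eq0 (inj_eq cinj) eq_sym.
  exists (fun i => (P i).[c i]), (fun i => (P i).[c i]^-1 *: P i).
  split=> // [i j|i]; last by rewrite scalerA mulfV // scale1r /w (bigD1 i).
  rewrite hornerZ; case: eqVneq => [<-|ij]; first by rewrite mulVf.
  by rewrite (PE i (c j)) (bigD1 j) 1?eq_sym //= subrr mul0r mulr0.
have sizew : size w = N.+1 by rewrite /w -big_enum size_prod_XsubC size_enum_ord.
have sizeL i : size (L i) = N.
  have w0 : w != 0 by rewrite -size_poly_eq0 sizew.
  have dL0 : d i *: L i != 0.
    by apply: contraNneq w0; rewrite (wE i) => ->; rewrite mulr0.
  move: sizew; rewrite (wE i) size_monicM ?monicXsubC // size_XsubC.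
  by rewrite size_scale // => -[].
(* The linear factor is 1 at [c i], and its slope cancels the derivative of [L i ^+ 2] there. At the
   other nodes [L i ^+ 2] already has a double zero. *)
pose H i := L i ^+ 2 * (1 - ((L i)^`().[c i] *+ 2) *: ('X - (c i)%:P)).
have sizeH i : (size (H i) <= N.*2)%N.
  rewrite (leq_trans (size_polyMleq _ _)) // -subn1 leq_subLR.
  have -> : (1 + N.*2 = (N + N).-1 + 2)%N.
    by rewrite addnn addn2 prednK ?double_gt0.
  rewrite leq_add // ?(leq_trans (size_polyMleq _ _)) ?sizeL //.
  rewrite (leq_trans (size_polyD _ _)) // geq_max size_poly1 /= size_polyN.
  by rewrite (leq_trans (size_scale_leq _ _)) // size_XsubC.
have HE i j : (H i).[c j] = (i == j)%:R.
  rewrite /H !hornerE LE; case: eqVneq => [<-|_]; last by rewrite expr0n mul0r.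
  by rewrite subrr mulr0 subr0 expr1n mulr1.
have dHE i j : (H i)^`().[c j] = 0.
  rewrite /H expr2 !derivM !poly.derivE !hornerE LE.
  case: eqVneq => [<-|_]; last by rewrite !(mul0r, mulr0, addr0).
  rewrite mulr1n; ring.
have sumH : \sum_i H i = 1.
  (* The difference has a double zero at each of the [N] nodes, so [w ^+ 2], of degree [2N], divides
     it; by [sizeH] its degree is below [2N], so it vanishes. *)
  apply/subr0_eq/eqP; apply: contraT => nz.
  have : w ^+ 2 %| \sum_i H i - 1.
    rewrite -prodrXl; apply: dvdp_prod_coprimep => [|i j ij|j].
    - exact: index_enum_uniq.
    - apply/coprimep_expl/coprimep_expr; rewrite coprimep_XsubC root_XsubC.
      by rewrite (inj_eq cinj) eq_sym.
    apply: dvdp_sqr_XsubC.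
      rewrite !hornerE horner_sum (bigD1 j) //= HE eqxx big1 ?addr0 ?subrr //.
      by move=> i ij; rewrite HE (negPf ij).
    rewrite !poly.derivE subr0 raddf_sum horner_sum big1 // => i _.
    exact: dHE.
  move=> /(dvdp_leq nz); rewrite leqNgt => /negP[].
  have -> : size (w ^+ 2) = N.*2.+1.
    rewrite -[LHS]prednK ?size_exp ?sizew ?muln2 //.
    by rewrite size_poly_gt0 expf_neq0 // -size_poly_eq0 sizew.
  rewrite ltnS (leq_trans (size_polyD _ _)) // geq_max size_polyN size_poly1.
  rewrite double_gt0 N0 andbT (leq_trans (size_sum _ _ _)) //.
  exact/bigmax_leqP.
have wyE i y : w.[y] = (y - c i) * (d i * (L i).[y]).
  by rewrite (wE i) hornerM hornerXsubC hornerZ.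
pose M := 1 + \sum_i ((L i)^`().[c i] / d i) ^+ 2.
have M0 : 0 < M by rewrite ltr_pwDl // sumr_ge0 // => i _; exact: sqr_ge0.
exists (fun i => H i + M *: w ^+ 2); split=> [i y|i j|y yc].
- rewrite hornerD hornerZ hornerM !horner_exp (wyE i).
  rewrite hornerD hornerN hornerC hornerZ hornerXsubC.
  set l := (L i).[y]; set a := (L i)^`().[c i]; set t := y - c i.
  have -> : l ^+ 2 * (1 - a *+ 2 * t) + M * (t * (d i * l)) ^+ 2 =
    l ^+ 2 * ((1 - a * t) ^+ 2 + (M - (a / d i) ^+ 2) * (d i * t) ^+ 2).
    by field.
  rewrite mulr_ge0 ?sqr_ge0 // addr_ge0 ?sqr_ge0 // mulr_ge0 ?sqr_ge0 //.
  rewrite subr_ge0 /M (bigD1 i) //=.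
  rewrite addrCA lerDl addr_ge0 // sumr_ge0 // => j _; exact: sqr_ge0.
- by rewrite hornerD HE hornerZ horner_exp (wyE j) subrr mul0r expr0n mulr0
     addr0.
(* Since the [H i] sum to 1, the excess over 1 is [N] copies of the correction, positive where [w]
   does not vanish. *)
have -> : \sum_i (H i + M *: w ^+ 2).[y] = 1 + N%:R * (M * w.[y] ^+ 2).
  under eq_bigr do rewrite hornerD hornerZ horner_exp.
  by rewrite big_split /= -horner_sum sumH hornerC sumr_const card_ord
     [N%:R * _]mulr_natl.
rewrite ltrDl mulr_gt0 ?ltr0n // mulr_gt0 // exprn_even_gt0 //= horner_prod.
by apply/prodf_neq0 => j _; rewrite !hornerE subr_eq0.
Qed.

Section argmin_poly.
Import -(notations) mpoly.

(** The triangle inequality over the monomials suffices, since each coordinate is at most the norm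
    of the vector. *)
Lemma evalv_bounded (R : realType) (n : nat) (X : set 'rV[R]_n)
    (q : mpoly n R) :
  bounded_set X -> exists K, forall x, X x -> `|evalv q x| <= K.
Proof.
(* Boundedness provides norm bounds only by numbers strictly above [B], hence [B + 1]. *)
move=> [B [_ /(_ (B + 1))]]; rewrite ltrDl ltr01 => /(_ isT) XB.
exists (\sum_(m <- msupp q) `|mcoeff m q| * \prod_i (B + 1) ^+ m i).
move=> x /XB xB.
rewrite /evalv mevalE (le_trans (ler_norm_sum _ _ _)) // ler_sum // => m _.
rewrite normrM ler_wpM2l // normr_prod ler_prod // => i _.
have xi : `|x ord0 i| <= B + 1.
  apply: le_trans xB; rewrite /= [leRHS]mx_normrE.
  exact: (le_bigmax _ (fun ij => `|x ij.1 ij.2|) (ord0, i)).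
by rewrite normr_ge0 normrX lerXn2r ?nnegrE // (le_trans _ xi).
Qed.

Definition lift_x (R : realType) (n : nat) (q : mpoly n R) : mpoly (n + 1) R :=
  comp_mpoly [tuple mpolyX R (mnm1 (lshift 1 i)) | i < n] q.

Definition lift_y (R : realType) (n : nat) (h : {poly R}) : mpoly (n + 1) R :=
  (map_poly (@mpolyC (n + 1) R) h).[mpolyX R (mnm1 (rshift n ord0))].

Lemma evalxy_lift_x (R : realType) (n : nat) (q : mpoly n R) (x : 'rV[R]_n) y :
  evalxy (lift_x q) x y = evalv q x.
Proof.
rewrite /evalxy /evalv comp_mpoly_meval; apply: meval_eq => i.
by rewrite tnth_mktuple mevalXU row_mxEl.
Qed.

Lemma evalxy_lift_y (R : realType) (n : nat) (h : {poly R}) (x : 'rV[R]_n) y :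
  evalxy (lift_y n h) x y = h.[y].
Proof.
rewrite /evalxy /evalv /lift_y -horner_map /= mevalXU row_mxEr mxE eqxx mulr1n.
(* Embedding the coefficients as constants and then evaluating them gives them back. *)
congr (_.[_]); apply/polyP => k; rewrite !coef_map_id0 ?mevalC ?mpolyC0 ?meval0 //.
Qed.

Lemma exists_evalxy (R : realType) (n N : nat) (g : 'I_N -> mpoly n R) (K : R)
    (h : 'I_N -> {poly R}) :
  exists p : mpoly (n + 1) R, forall x y,
    evalxy p x y = \sum_i (evalv (g i) x + K) * (h i).[y].
Proof.
exists (\sum_i (lift_x (g i) + mpolyC _ K) * lift_y n (h i)) => x y.
rewrite /evalxy /evalv raddf_sum; apply: eq_bigr => i _ /=.
rewrite mevalM mevalD mevalC; congr ((_ + _) * _).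
  exact: evalxy_lift_x.
exact: evalxy_lift_y.
Qed.

End argmin_poly.

Theorem theorem2p1 (R : realType) (n N : nat) (X : set 'rV[R]_n)
    (hX : bounded_set X)
    (g : 'I_N -> mpoly.mpoly n R)
    (c : 'I_N -> R) (hc : injective c)
    (f : 'rV[R]_n -> R)
    (hf : forall (i : 'I_N) (x : 'rV[R]_n), region X g i x -> f x = c i) :
  exists p : mpoly.mpoly (n + 1) R,
    forall x : 'rV[R]_n, (\bigcup_(i : 'I_N) region X g i) x ->
      is_argmin (fun y : R => evalxy p x y) (f x).
Proof.
(* For [N = 0] the union of the regions is empty and any polynomial will do; the interpolants exist
   only for [0 < N], an empty sum being 0. *)
have [N0|N0] := posnP N.
  have [p _] := exists_evalxy g 0 (fun=> 0).
  by exists p => x [i]; have := ltn_ord i; rewrite {2}N0.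
have [B hB] := choice (fun j => evalv_bounded (g j) hX).
have [h [h0 hE h1]] := nonneg_hermite N0 hc.
(* As [- B j <= evalv (g j) x] on [X], this makes every shifted value at least 1. One shift common
   to all [j] preserves the order of the [g j]. *)
pose K := 1 + \sum_j `|B j|.
have gK j x : X x -> 0 < evalv (g j) x + K.
  move=> /(hB j); rewrite ler_norml => /andP[lb _].
  have : B j <= \sum_j `|B j|.
    by rewrite (bigD1 j) //= (le_trans (ler_norm _)) // lerDl sumr_ge0.
  by rewrite /K; lra.
have [p pE] := exists_evalxy g K h.
exists p => x [i _ xi]; rewrite (hf i x xi); case: xi => Xx gi.
have pc j : evalxy p x (c j) = evalv (g j) x + K.
  rewrite pE (bigD1 j) //= hE eqxx mulr1 big1 ?addr0 // => k kj.
  by rewrite hE (negPf kj) mulr0.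
have lt z : z != c i -> evalxy p x (c i) < evalxy p x z.
  move=> zi; have [[j zj]|/forallNP zc] := pselect (exists j, z = c j).
    rewrite zj !pc ltrD2r gi //; apply: contraNneq zi => <-; exact/eqP.
  have /h1 z1 : forall j, z != c j by move=> j; exact/eqP/zc.
  (* The first inequality is strict because the sum exceeds 1 and its factor is positive; the second
     holds termwise, by minimality of [g i] at [x] and nonnegativity of the [h j]. *)
  rewrite pc -[ltLHS]mulr1 (@lt_le_trans _ _
    ((evalv (g i) x + K) * \sum_j (h j).[z])) ?ltr_pM2l ?gK //.
  rewrite pE mulr_sumr ler_sum // => j _; rewrite ler_wpM2r // lerD2r.
  by have [->//|ji] := eqVneq j i; exact/ltW/gi.
split=> [z|z zmin].
  by have [->//|/lt/ltW] := eqVneq z (c i).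
by apply/eqP; apply: contraT => /[1!eq_sym] /lt; rewrite ltNge zmin.
Qed.
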